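(* Let $\delta>0$. For $a>0$, $u>0$ and $b\in\mathbb{R}$ with $b<a/u$, $$\mathbf{P}^{(\delta)}_{0,u,0}\left(\sup_{t\leq u}\{\omega_t+bt\}<a\right)=\mathbf{P}^{(\delta)}_{0,u,0}\left(\sup_{t\leq u}\{\omega_t\}<\sqrt{a(a-bu)}\right).$$
   Context: $\mathbf{P}^{(\delta)}_{0,u,0}$ denotes the law of the Bessel bridge from $0$ to $0$ of length $u$ with dimension parameter $\delta>0$, i.e. the law of the Bessel process $(\omega_t)_{0\le t\le u}$ of dimension $\delta$ started at $0$ and conditioned on $\omega_u=0$. For $0<\delta<2$ the Bessel process is taken to be instantly reflecting at $0$. $\omega_t$ denotes the coordinate process on the space of continuous functions. *)

(* Defs.v *)
From HB Require Import structures.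
From mathcomp Require Import all_boot all_order all_algebra.
From mathcomp Require Import all_classical all_reals all_analysis.

Set Implicit Arguments.
Unset Strict Implicit.
Unset Printing Implicit Defensive.

Import Order.TTheory GRing.Theory Num.Theory.
Import numFieldNormedType.Exports.

Local Open Scope classical_set_scope.
Local Open Scope ring_scope.

(** * The space C([0, u]) of continuous real functions on [0, u] *)

Section path_space.
Context {R : realType} (u : R).

Definition cpath : Type := continuousType (`[0, u]%classic : set R) R.

HB.instance Definition _ := Choice.on cpath.
HB.instance Definition _ := isPointed.Build cpath
  (mkcts (@cst_continuous (`[0, u]%classic : set R) R 0)).

(* The coordinate process; extended by 0 to times outside [0, u], which are
   never used. *)
Definition omega (t : R) (w : cpath) : R := 'valL_0 (w : _ -> R) t.

Definition cylinders : set (set cpath) :=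
  \bigcup_(t in `[0, u]) preimage_set_system setT (omega t) measurable.

(* C([0, u]) with the sigma-algebra generated by the coordinates. *)
Definition pathSpace := g_sigma_algebraType cylinders.
HB.instance Definition _ := Measurable.on pathSpace.

(* C([0, u]) with the topology of uniform convergence. *)
Definition unifPath := initial_topology
  (fun w : cpath => (w : {uniform (`[0, u]%classic : set R) -> R})).
HB.instance Definition _ := Topological.on unifPath.

End path_space.

(** * Bessel processes *)

Section bessel.
Context {R : realType}.
Implicit Types (delta nu s t u x y z : R).

Definition Gamma s : R :=
  \int[lebesgue_measure]_(x in `]0, +oo[) (x `^ (s - 1) * expR (- x)).

(* Modified Bessel function of the first kind I_nu(z), for z > 0, nu > -1. *)
Definition besselI nu z : R :=
  limn (series (fun k : nat =>
    (z / 2) `^ (nu + 2 * k%:R) / (k`!%:R * Gamma (nu + k%:R + 1)))).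

(* Transition density, with respect to Lebesgue measure on [0, +oo[, of the
   Bessel process of dimension delta > 0 (index nu = delta / 2 - 1).  When
   0 < delta < 2, I_nu with nu < 0 gives the process instantaneously reflected
   at 0 (I_(- nu) would give the process killed at 0). *)
Definition bessel_density delta t x y : R :=
  let nu := delta / 2 - 1 in
  if x == 0 then
    y `^ (2 * nu + 1) * expR (- (y ^+ 2 / (2 * t))) /
      (2 `^ nu * t `^ (nu + 1) * Gamma (nu + 1))
  else
    t^-1 * (y / x) `^ nu * y * expR (- ((x ^+ 2 + y ^+ 2) / (2 * t))) *
      besselI nu (x * y / t).

(* For l = [:: (t_1, B_1); ...; (t_n, B_n)] with s < t_1 < ... < t_n, the
   probability that the Bessel process, being at x at time s, is in B_i at
   time t_i for all i:
     \int_(B_1) p_(t_1 - s)(x, y_1) \int_(B_2) p_(t_2 - t_1)(y_1, y_2) ...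
   where the integrals are over the nonnegative parts of the B_i. *)
Fixpoint bessel_fdd delta s x (l : seq (R * set R)) : \bar R :=
  if l is (t, B) :: l' then
    (\int[lebesgue_measure]_(y in B `&` `[0%R, +oo[)
       ((bessel_density delta (t - s) x y)%:E * bessel_fdd delta t y l'))%E
  else 1%E.

(* P is the law of the Bessel process (omega_t)_(0 <= t <= u) of dimension
   delta started at x. *)
Definition bessel_law delta x u (P : probability (pathSpace u) R) : Prop :=
  P (omega 0 @^-1` [set x]) = 1%E /\
  forall l : seq (R * set R),
    path <%R 0 (unzip1 l) ->
    (forall tB, tB \in l -> tB.1 <= u /\ measurable tB.2) ->
    P [set w | forall tB, tB \in l -> tB.2 (omega tB.1 w)]
    = bessel_fdd delta 0 x l.

(* kappa is a regular conditional distribution, under P, of the path given its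
   final value: P(A, omega_u \in B) = E[kappa(omega_u, A); omega_u \in B]. *)
Definition regular_conditional_law u (P : probability (pathSpace u) R)
    (kappa : R.-pker R ~> pathSpace u) : Prop :=
  forall (A : set (pathSpace u)) (B : set R), measurable A -> measurable B ->
    P (A `&` omega u @^-1` B)
    = (\int[P]_(w in omega u @^-1` B) kappa (omega u w) A)%E.

(* y |-> kappa y is continuous on [0, +oo[ for the weak convergence of measures
   on C([0, u]) with the uniform norm. *)
Definition weakly_continuous u (kappa : R.-pker R ~> pathSpace u) : Prop :=
  forall F : unifPath u -> R, continuous F -> bounded_fun F ->
    {within `[0, +oo[, continuous
      (fun y => \int[kappa y]_w F (w : unifPath u))}.

(* Q is the law of the Bessel process of dimension delta started at x and
   conditioned on omega_u = y.  A regular conditional distribution given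
   omega_u is only determined for almost every y; its value at y is that of
   its (unique) weakly continuous version on [0, +oo[. *)
Definition bessel_bridge_law delta x u y (Q : probability (pathSpace u) R)
    : Prop :=
  exists (P : probability (pathSpace u) R) (kappa : R.-pker R ~> pathSpace u),
    [/\ bessel_law delta x P,
        regular_conditional_law P kappa,
        weakly_continuous kappa &
        forall A, measurable A -> Q A = kappa y A].

End bessel.

Arguments bessel_bridge_law {R} (delta x u y)%_ring_scope Q.

(* Main.v *)
(* For lam > 0 put k = (1/lam - lam)/u, g(t) = lam + k t and
   theta(t) = t/(lam g(t)), an increasing bijection of [0, u] fixing 0 and u.
   The bridge from 0 to 0 is invariant under w |-> (g(t) w(theta(t)))_t, which
   turns the barrier a - b t into the constant sqrt(a(a - b u)) when
   lam = sqrt((a - b u)/a).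

   Since theta(t) - theta(s) = (t - s)/(g(s) g(t)), the Bessel transition
   densities satisfy p(theta(t) - theta(s), x, y) =
   p(t - s, g(s) x, g(t) y) g(t) h(t, g(t) y)/h(s, g(s) x) with
   h(t, y) = g(t)^(- delta/2) exp(k y^2/(2 g(t))); the argument of the Bessel
   function is unchanged, so nothing about I_nu beyond I_nu >= 0 is needed.
   Hence the factors h telescope in the finite-dimensional laws of the free
   process, and the transformation changes its law by a factor depending only on
   the final value; conditioning on w(u) in [0, r[ and letting r -> 0 removes
   this factor.  Comparing closed boxes with slightly larger ones makes one-sided
   estimates suffice, and equality follows by using both lam and 1/lam. *)
From HB Require Import structures.
Require Import Defs.
From mathcomp Require Import all_boot all_order all_algebra.
From mathcomp Require Import all_classical all_reals all_analysis.
From mathcomp Require Import measurable_realfun ring lra.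

Import Order.TTheory GRing.Theory Num.Theory.
Import numFieldNormedType.Exports.

Local Open Scope classical_set_scope.
Local Open Scope ring_scope.

(** * Scaling of integrals *)

Section scaling.
Import HBNNSimple.
Context {R : realType}.
Local Notation mu := (@lebesgue_measure R).

Lemma preimage_mulr_itvoc (g a b : R) : 0 < g ->
  ( *%R g) @^-1` `]a, b] = `]a / g, b / g]%classic.
Proof.
move=> g0; apply/seteqP; split => y /=;
by rewrite !in_itv/= ltr_pdivrMr// ler_pdivlMr// mulrC.
Qed.

(** Uniqueness of Lebesgue measure: [g] times its pushforward under multiplication by [g] gives
    every []a, b]] the right length. *)
Lemma lebesgue_measureM (g : R) (A : set R) : 0 < g -> measurable A ->
  (mu (( *%R g : R -> R) @^-1` A) = (g^-1)%:E * mu A)%E.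
Proof.
move=> g0 mA.
have mg : measurable_fun setT ( *%R g : R -> measurableTypeR R).
  exact: mulrl_measurable.
pose m := pushforward mu ( *%R g : _ -> measurableTypeR R).
pose gn : {nonneg R} := NngNum (ltW g0).
pose mm : {measure set (measurableTypeR R) -> \bar R} := mscale gn m.
have -> : mu A = mm mg A.
  apply: lebesgue_measure_unique => //= _ [[a b]] _ <-.
  rewrite /mm /mscale/= /m /pushforward preimage_mulr_itvoc//.
  rewrite !lebesgue_measure_itv/= !lte_fin.
  rewrite ltr_pM2r ?invr_gt0//; case: ifP => _; last by rewrite mule0.
  by rewrite -!EFinB -EFinM; congr (_%:E); field; rewrite gt_eqF.
by rewrite /mm /mscale/= muleA -EFinM mulVf ?gt_eqF// mul1e.
Qed.

(* No measurability of f1 and f2: their integrals are suprema over simple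
   functions, and only the simple functions are rescaled.  This avoids proving
   that the iterated integrals of bessel_fdd are measurable in the starting
   point. *)
Lemma integral_le_scale (c g : R) (f1 f2 : R -> \bar R) (D : set R) :
  0 < c -> 0 < g ->
  (forall y, D (g * y)%R -> 0 <= f1 y)%E -> (forall y, D y -> 0 <= f2 y)%E ->
  (forall y, D (g * y)%R -> f1 y <= c%:E * f2 (g * y)%R)%E ->
  (\int[mu]_(y in ( *%R g : R -> R) @^-1` D) f1 y <=
    (c / g)%R%:E * \int[mu]_(y in D) f2 y)%E.
Proof.
move=> c0 g0 f10 f20 f12.
rewrite !ge0_integralE//.
apply: ge_ereal_sup => /= _ [h /= hf <-].
have [k kE] : exists k : {nnsfun (measurableTypeR R) >-> R},
    forall y, k y = c^-1 * h (g^-1 * y).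
  pose k0 (y : measurableTypeR R) := c^-1 * h (g^-1 * y).
  have mV : measurable_fun setT (fun y : R => g^-1 * y : R) by exact: mulrl_measurable.
  have mk : measurable_fun setT (fun y : R => c^-1 * h (g^-1 * y)).
    by apply: measurable_funM => //; apply: (@measurableT_comp _ _ _ _ _ _ h) => //.
  have fk : finite_set (range k0).
    apply: (@sub_finite_set _ _ (( *%R c^-1) @` range h)); last first.
      by apply: finite_image; exact: fimfunP.
    by move=> _ [y _ <-]; exists (h (g^-1 * y)) => //; exists (g^-1 * y).
  have nk y : 0 <= k0 y by rewrite mulr_ge0 ?fun_ge0// invr_ge0 ltW.
  pose k1 := isMeasurableFun.Build _ _ (measurableTypeR R) R k0 mk.
  pose k2 := FiniteImage.Build _ _ k0 fk.
  pose k3 := isNonNegFun.Build _ _ k0 nk.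
  by exists (HB.pack_for {nnsfun (measurableTypeR R) >-> R} k0 k1 k2 k3).
rewrite -[X in (X <= _)%E](_ : (\int[mu]_y (h y)%:E)%E = _); last first.
  by rewrite integral_nnsfun// patch_setT.
have -> : (\int[mu]_y (h y)%:E = c%:E * \int[mu]_y (k (g * y)%R)%:E)%E.
  rewrite -ge0_integralZl//; first last.
  - by rewrite lee_fin ltW.
  - by move=> y _; rewrite lee_fin.
  - apply/measurable_EFinP.
    by apply: (measurableT_comp (f := k)) => //; exact: mulrl_measurable.
  apply: eq_integral => y _.
  by rewrite -EFinM kE mulrA mulfV ?gt_eqF// mul1r mulrA mulVf ?gt_eqF// mul1r.
have mg : measurable_fun setT ( *%R g : measurableTypeR R -> measurableTypeR R).
  exact: mulrl_measurable.
have -> : (\int[mu]_y (k (g * y)%R)%:E = (g^-1)%:E * \int[mu]_y (k y)%:E)%E.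
  have /= := @ge0_integral_pushforward _ _ _ _ R _ mg mu setT (EFin \o k) measurableT.
  rewrite /comp preimage_setT => <-; first last.
  - by move=> y _; rewrite lee_fin.
  - by apply/measurable_EFinP.
  have gi0 : 0 <= g^-1 by rewrite invr_ge0 ltW.
  rewrite (@eq_measure_integral _ _ _ _ (mscale (NngNum gi0) mu)).
    rewrite ge0_integral_mscale//; first exact/measurable_EFinP.
    by move=> y _; rewrite lee_fin.
  by move=> A mA _; exact: lebesgue_measureM.
rewrite muleA -EFinM lee_pmul2l ?lte_fin ?divr_gt0//.
apply: ereal_sup_ubound; exists k; last first.
  by rewrite integral_nnsfun// patch_setT.
move=> y /=.
have gy : g * (g^-1 * y) = y by rewrite mulrA mulfV ?gt_eqF// mul1r.
have := hf (g^-1 * y); rewrite kE /patch.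
case: ifPn => [|] /=; rewrite ?notin_setE ?inE /= gy => Dy hy.
  rewrite mem_set// -(@lee_pmul2l _ c%:E) ?lte_fin// -EFinM mulrA mulfV ?gt_eqF// mul1r.
  by rewrite (le_trans hy)// -{2}gy f12 /= ?gy.
by rewrite memNset// EFinM pmule_rle0// lte_fin invr_gt0.
Qed.
End scaling.

(** * Transition densities and finite-dimensional laws under the time change *)

Section density.
Context {R : realType}.
Implicit Types (delta g k s t u x y z : R).

Lemma Gamma_ge0 s : 0 <= Gamma s.
Proof.
apply: fine_ge0; apply: integral_ge0 => y _.
by rewrite lee_fin mulr_ge0 ?powR_ge0 ?expR_ge0.
Qed.

Lemma besselI_ge0 nu z : 0 <= besselI nu z.
Proof.
rewrite /besselI; set a := series _.
have a0 n : 0 <= a n.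
  rewrite /a /series/=; apply: sumr_ge0 => i _.
  by rewrite divr_ge0 ?powR_ge0// mulr_ge0 ?ler0n ?Gamma_ge0.
(* A divergent series has the default limit 0, so the bound holds in both cases. *)
have [ca|/dvgP->//] := pselect (cvgn a).
by apply: limr_ge => //; apply: nearW.
Qed.

Lemma bessel_density_ge0 delta t x y :
  0 <= t -> 0 <= y -> 0 <= bessel_density delta t x y.
Proof.
move=> t0 y0; rewrite /bessel_density/=; case: ifP => _.
  by rewrite !mulr_ge0 ?powR_ge0 ?expR_ge0// invr_ge0 !mulr_ge0 ?powR_ge0 ?Gamma_ge0.
by rewrite !mulr_ge0 ?invr_ge0 ?powR_ge0 ?expR_ge0 ?besselI_ge0.
Qed.

(* The space-time harmonic factor h(t, z), with g standing for g(t). *)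
Definition bessel_h delta k g z := g `^ (- (delta / 2)) * expR (k * z ^+ 2 / (2 * g)).

Lemma bessel_h_gt0 delta k g z : 0 < g -> 0 < bessel_h delta k g z.
Proof. by move=> g0; rewrite mulr_gt0 ?powR_gt0 ?expR_gt0. Qed.

Let powD g r s : 0 < g -> g `^ (r + s) = g `^ r * g `^ s.
Proof. by move=> g0; rewrite powRD// (gt_eqF g0) implybT. Qed.

Let powV g r : 0 <= g -> g^-1 `^ r = (g `^ r)^-1.
Proof. by move=> g0; rewrite -!powR_inv1 ?powR_ge0// powRAC. Qed.

(** The powers of [gs] and [gt] balance, and substituting [k = (gt - gs) / t] turns the difference
    of the Gaussian exponents into the exponents of the two factors [bessel_h]. *)
Lemma bessel_density_moebius delta k t gs gt x y :
  0 < t -> 0 < gs -> 0 < gt -> gt - gs = k * t -> 0 <= x -> 0 <= y ->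
  bessel_density delta (t / (gs * gt)) x y =
  bessel_density delta t (gs * x) (gt * y) * gt *
    bessel_h delta k gt (gt * y) / bessel_h delta k gs (gs * x).
Proof.
move=> t0 gs0 gt0 gE x0 y0; rewrite /bessel_density/= /bessel_h.
rewrite mulf_eq0 (gt_eqF gs0) orFb.
set nu := delta / 2 - 1.
have -> : delta / 2 = nu + 1 by rewrite /nu subrK.
have powS g : 0 < g -> g `^ (nu + 1) = g `^ nu * g.
  by move=> g0; rewrite powD// powRr1// ltW.
have powNS g : 0 < g -> g `^ (- (nu + 1)) = (g `^ nu * g)^-1.
  by move=> g0; rewrite powRN powS.
rewrite !powNS//.
have a0 : gs `^ nu != 0 by rewrite gt_eqF ?powR_gt0.
have b0 : gt `^ nu != 0 by rewrite gt_eqF ?powR_gt0.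
have [gs0' gt0' t0'] : [/\ gs != 0, gt != 0 & t != 0] by split; rewrite gt_eqF.
case: ifPn => [/eqP ->|xn0].
  have -> : expR (- (y ^+ 2 / (2 * (t / (gs * gt))))) =
      expR (- ((gt * y) ^+ 2 / (2 * t))) * expR (k * (gt * y) ^+ 2 / (2 * gt)).
    have -> : k = (gt - gs) / t by rewrite gE mulfK.
    by rewrite -expRD; congr expR; field; rewrite gs0' gt0' t0'.
  rewrite mulr0 expr0n/= mulr0 mul0r expR0 mulr1.
  have -> : (gt * y) `^ (2 * nu + 1) = gt `^ nu ^+ 2 * gt * y `^ (2 * nu + 1).
    rewrite powRM ?(ltW gt0)//; congr (_ * _).
    rewrite powD// powRr1 ?ltW//; congr (_ * _).
    by rewrite (_ : 2 * nu = nu + nu) ?powD ?expr2//; ring.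
  have -> : (t / (gs * gt)) `^ (nu + 1) =
      t `^ (nu + 1) / (gs `^ nu * gs * (gt `^ nu * gt)).
    rewrite powRM ?invr_ge0 ?mulr_ge0 ?ltW//.
    by rewrite powV ?mulr_ge0 ?ltW// powRM ?ltW// !powS.
  have d0 : t `^ (nu + 1) != 0 by rewrite gt_eqF ?powR_gt0.
  (* The inverse of [Gamma] becomes an opaque factor, so that [field] does not ask for [Gamma] to be
     nonzero. *)
  rewrite ![in (_ * Gamma _)^-1]invfM; move: (Gamma _)^-1 (2 `^ nu)^-1 => G c; field.
  by rewrite a0 b0 gs0' gt0' d0 gt_eqF ?powR_gt0.
have -> : expR (- ((x ^+ 2 + y ^+ 2) / (2 * (t / (gs * gt))))) =
   expR (- (((gs * x) ^+ 2 + (gt * y) ^+ 2) / (2 * t))) *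
   expR (k * (gt * y) ^+ 2 / (2 * gt)) / expR (k * (gs * x) ^+ 2 / (2 * gs)).
  have -> : k = (gt - gs) / t by rewrite gE mulfK.
  by rewrite -expRN -!expRD; congr expR; field; rewrite gs0' gt0' t0'.
have -> : x * y / (t / (gs * gt)) = gs * x * (gt * y) / t.
  by field; rewrite gs0' gt0' t0'.
have -> : ((gt * y) / (gs * x)) `^ nu = gt `^ nu / gs `^ nu * (y / x) `^ nu.
  rewrite (_ : _ / _ = (gt / gs) * (y / x)); last by rewrite invfM mulrACA.
  have gsi : 0 <= gs^-1 by rewrite invr_ge0 ltW.
  rewrite (@powRM _ (gt / gs)) ?divr_ge0 ?(ltW gt0) ?(ltW gs0)//.
  by rewrite (@powRM _ gt gs^-1) ?(ltW gt0)// powV// ltW.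
have e0 : expR (k * (gs * x) ^+ 2 / (2 * gs)) != 0 by rewrite gt_eqF ?expR_gt0.
set e := expR _ in e0 *; field.
by rewrite ?a0 ?b0 ?gs0' ?gt0' ?t0' ?e0.
Qed.
End density.

(** * Finite-dimensional laws under the time change *)

Section fdd.
Context {R : realType}.
Implicit Types (delta lam k s t u x y : R) (l : seq (R * set R)).

Lemma bessel_fdd_ge0 delta s x l : path <%R s (unzip1 l) ->
  (0 <= bessel_fdd delta s x l)%E.
Proof.
elim: l s x => [//|[t B] l IH] s x /= /andP[st pl].
apply: integral_ge0 => y [_]; rewrite /= in_itv/= andbT => y0.
by rewrite mule_ge0 ?IH// lee_fin bessel_density_ge0// subr_ge0 ltW.
Qed.

Definition clock lam k t := t / (lam * (lam + k * t)).

Lemma clockB lam k s t : lam != 0 -> lam + k * s != 0 -> lam + k * t != 0 ->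
  clock lam k t - clock lam k s = (t - s) / ((lam + k * s) * (lam + k * t)).
Proof. by move=> l0 s0 t0; rewrite /clock; field; rewrite l0 s0 t0. Qed.

(** The event [tB] for the transformed path t |-> g(t) w(theta(t)), rewritten as an event for w. *)
Definition moebius_event lam k (tB : R * set R) : R * set R :=
  (clock lam k tB.1, *%R (lam + k * tB.1) @^-1` tB.2).

Lemma clock_path lam k s l : 0 < lam -> path <%R s (unzip1 l) ->
  (forall t, t \in s :: unzip1 l -> 0 < lam + k * t) ->
  path <%R (clock lam k s) (unzip1 (map (moebius_event lam k) l)).
Proof.
move=> lam0; elim: l s => [//|[t B] l IH] s /= /andP[st pl] gpos.
have gs0 : 0 < lam + k * s by apply: gpos; rewrite inE eqxx.
have gt0 : 0 < lam + k * t by apply: gpos; rewrite !inE eqxx orbT.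
apply/andP; split; last first.
  by apply: IH => // r rl; apply: gpos; rewrite inE rl orbT.
by rewrite -subr_gt0 clockB ?gt_eqF// divr_gt0 ?mulr_gt0// subr_gt0.
Qed.

(** Induction on [l]: each integration variable is rescaled by g(t), and the density identity
    produces quotients h(t, .)/h(s, .) that telescope. Only h at the last time survives, and [M]
    bounds it. The default entry of [last] is the starting point, which lets the induction begin at
    the empty list. *)
Lemma bessel_fdd_moebius delta lam k (M : R) s x l :
  0 < lam -> path <%R s (unzip1 l) ->
  (forall t, t \in s :: unzip1 l -> 0 < lam + k * t) ->
  0 <= x -> 0 < M ->
  (forall y, 0 <= y -> (last (s, [set (lam + k * s) * x]) l).2 y ->
    bessel_h delta k (lam + k * (last (s, [set (lam + k * s) * x]) l).1) y <= M) ->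
  (bessel_fdd delta (clock lam k s) x (map (moebius_event lam k) l) <=
   (M / bessel_h delta k (lam + k * s) ((lam + k * s) * x))%:E *
     bessel_fdd delta s ((lam + k * s) * x) l)%E.
Proof.
move=> lam0; elim: l s x => [|[t B] l IH] s x /= pl gpos x0 M0 hM.
  have gs0 := gpos _ (mem_head _ _).
  rewrite mule1 lee_fin ler_pdivlMr ?mul1r ?bessel_h_gt0// hM//.
  by rewrite mulr_ge0// ltW.
have gs0 : 0 < lam + k * s by apply: gpos; rewrite inE eqxx.
have gt0 : 0 < lam + k * t by apply: gpos; rewrite !inE eqxx orbT.
have /andP[st {}pl] := pl.
have hs0 := bessel_h_gt0 delta k _ ((lam + k * s) * x) gs0.
set gs := lam + k * s in gs0 hs0 *; set gt := lam + k * t in gt0 *.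
have E : clock lam k t - clock lam k s = (t - s) / (gs * gt).
  by apply: clockB; rewrite gt_eqF.
have -> : *%R gt @^-1` B `&` `[0, +oo[ = *%R gt @^-1` (B `&` `[0, +oo[).
  by apply/seteqP; split=> y [By] /=; rewrite !in_itv/= !andbT pmulr_rge0.
(* The Jacobian [gt^-1] of the substitution is split off, as [integral_le_scale] requires. *)
have -> : M / bessel_h delta k gs (gs * x) =
    (M * gt / bessel_h delta k gs (gs * x)) / gt.
  by field; rewrite !gt_eqF.
apply: integral_le_scale => //.
- by rewrite divr_gt0// mulr_gt0.
- move=> y [_]; rewrite /= in_itv/= andbT pmulr_rge0// => y0.
  rewrite mule_ge0 ?lee_fin ?bessel_density_ge0 ?E ?divr_ge0 ?mulr_ge0 ?subr_ge0//;
    rewrite ?(ltW gs0) ?(ltW gt0) ?(ltW st)//.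
  apply: bessel_fdd_ge0.
  by apply: clock_path => // r rl; apply: gpos; rewrite inE rl orbT.
- move=> y [_]; rewrite /= in_itv/= andbT => y0.
  by rewrite mule_ge0 ?bessel_fdd_ge0// lee_fin bessel_density_ge0// subr_ge0 ltW.
move=> y [By]; rewrite /= in_itv/= andbT pmulr_rge0// => y0.
rewrite E (bessel_density_moebius delta k) ?subr_gt0//; last by rewrite /gs /gt; ring.
have ht0 := bessel_h_gt0 delta k _ (gt * y) gt0.
have gpos' r : r \in t :: unzip1 l -> 0 < lam + k * r.
  by move=> rl; apply: gpos; rewrite inE rl orbT.
have {}IH := IH t y pl gpos' y0 M0 _.
set p := bessel_density delta (t - s) (gs * x) (gt * y).
have p0 : 0 <= p by rewrite bessel_density_ge0 ?subr_ge0 ?(ltW st)// mulr_ge0// ltW.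
apply: (@le_trans _ _
  ((p * gt * bessel_h delta k gt (gt * y) / bessel_h delta k gs (gs * x))%:E *
   ((M / bessel_h delta k gt (gt * y))%:E * bessel_fdd delta t (gt * y) l)))%E.
  apply: lee_wpmul2l; first by rewrite lee_fin divr_ge0 ?mulr_ge0 ?powR_ge0// ltW.
  (* For an empty tail, the last event in the induction hypothesis is the singleton of [gt * y], a
     point of [B]. *)
  apply: IH => z z0; case: l pl gpos gpos' hM => [|tB l] _ _ _ hM; last exact: hM.
  by move=> /= zE; apply: hM => //; rewrite zE.
rewrite !muleA -!EFinM (_ : _ * (M / _) = M * gt / bessel_h delta k gs (gs * x) * p)//.
by field; rewrite !gt_eqF.
Qed.
End fdd.

(** * Path space and weak continuity of the conditional laws *)

Section paths.
Context {R : realType} (u : R).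
Implicit Types (t : R) (w : cpath u).

Lemma omegaE t (tu : t \in `[0, u]%classic) w : omega t w = w (exist _ t tu).
Proof.
by have := congr1 (fun f => f (exist _ t tu)) (@valLK _ _ (0 : R) `[0, u]%classic w).
Qed.

Lemma measurable_omega t : t \in `[0, u] ->
  measurable_fun setT (omega t : pathSpace u -> R).
Proof.
move=> tu _ B mB; rewrite setTI; apply: sub_sigma_algebra.
by exists t => //; exists B => //; rewrite setTI.
Qed.

Lemma measurable_omega_preimage t (B : set R) : t \in `[0, u] ->
  measurable B -> measurable (omega t @^-1` B : set (pathSpace u)).
Proof.
by move=> tu mB; rewrite -[X in measurable X]setTI; exact: measurable_omega.
Qed.

Lemma within_continuous_omega w : {within `[0, u], continuous (fun t => omega t w)}.
Proof. by apply/subspace_valL_continuousP'; exact: cts_fun. Qed.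

Lemma continuous_unif_omega t : t \in `[0, u] ->
  continuous (omega t : unifPath u -> R).
Proof.
move=> tu w; have tu' : t \in `[0, u]%classic by rewrite inE.
have iw : {for w, continuous (fun v : unifPath u =>
    (v : {uniform (`[0, u]%classic : set R) -> R}))}.
  exact: initial_continuous.
move=> A; rewrite omegaE => nA.
have [E entE EA] : exists2 E, entourage E & xsection E (w (exist _ t tu')) `<=` A.
  by move: nA; rewrite -nbhs_entourageE => -[E ? ?]; exists E.
have /iw : nbhs (w : {uniform (`[0, u]%classic : set R) -> R})
    [set f | A (f (exist _ t tu'))].
  apply/uniform_nbhs; exists E; split => // f wf /=.
  by apply: EA; apply/xsectionP; exact: wf.
apply: (filterS (F := nbhs (w : unifPath u))) => f /=; by rewrite omegaE.
Qed.

End paths.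

(** * Closed boxes and weak continuity *)

Section weak.
Context {R : realType}.

Definition below u (l : seq (R * R)) : set (pathSpace u) :=
  [set w | forall p, p \in l -> omega p.1 w <= p.2].

Definition relax (eta : R) (l : seq (R * R)) := [seq (p.1, p.2 + eta) | p <- l].

Lemma below_nil u : below u [::] = setT.
Proof. by apply/seteqP; split. Qed.

Lemma below_cons u p l :
  below u (p :: l) = omega p.1 @^-1` `]-oo, p.2] `&` below u l.
Proof.
apply/seteqP; split => w /=.
  move=> H; split; first by rewrite in_itv/= H// mem_head.
  by move=> q ql; apply: H; rewrite inE ql orbT.
by rewrite in_itv/= => -[H1 H2] q; rewrite inE => /predU1P[->//|/H2].
Qed.

Lemma measurable_below u l : {in l, forall p, p.1 \in `[0, u]} ->
  measurable (below u l).
Proof.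
elim: l => [_|p l IH lu]; first by rewrite below_nil.
rewrite below_cons; apply: measurableI; last first.
  by apply: IH => q ql; apply: lu; rewrite inE ql orbT.
by apply: measurable_omega_preimage => //; apply: lu; rewrite mem_head.
Qed.

(** Monotonicity of the integral. The real-valued integral agrees with the extended one because the
    latter is at most [m O <= 1]. *)
Lemma indic_sandwich d (T : measurableType d) (m : {measure set T -> \bar R})
    (F : T -> R) (C O : set T) :
  m setT = 1%E -> measurable_fun setT F -> measurable C -> measurable O ->
  (forall x, \1_C x <= F x) -> (forall x, F x <= \1_O x) ->
  (m C <= (\int[m]_x F x)%:E)%E /\ ((\int[m]_x F x)%:E <= m O)%E.
Proof.
move=> m1 mF mC mO CF FO.
have F0 x : 0 <= F x by rewrite (le_trans _ (CF x))// indicE ler0n.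
have mind A : measurable A -> measurable_fun setT (EFin \o (\1_A : T -> R)).
  by move=> mA; apply/measurable_EFinP.
have mFE : measurable_fun setT (EFin \o F) by apply/measurable_EFinP.
have h1 : (m C <= \int[m]_x (F x)%:E)%E.
  rewrite -[X in (m X <= _)%E]setIT -integral_indic//.
  apply: ge0_le_integral => //; first exact: mind.
  by move=> x _; rewrite lee_fin.
have h2 : (\int[m]_x (F x)%:E <= m O)%E.
  rewrite -[X in (_ <= m X)%E]setIT -integral_indic//.
  apply: ge0_le_integral => //; [|exact: mind|].
    by move=> x _; rewrite lee_fin.
  by move=> x _; rewrite lee_fin.
rewrite /Rintegral fineK//.
rewrite ge0_fin_numE; last by apply: integral_ge0 => x _; rewrite lee_fin.
have mO1 : (m O <= 1)%E by rewrite -m1; apply: le_measure; rewrite ?inE.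
by rewrite (le_lt_trans h2)// (le_lt_trans mO1)// ltry.
Qed.

Definition ramp (z : R) := Num.max 0 (Num.min 1 (1 - z)).

Lemma ramp_ge0 z : 0 <= ramp z. Proof. by rewrite le_max lexx. Qed.
Lemma ramp_le1 z : ramp z <= 1. Proof. by rewrite ge_max ler01 ge_min lexx. Qed.
Lemma ramp1 z : z <= 0 -> ramp z = 1.
Proof. by move=> z0; rewrite /ramp min_l ?max_r// lerBrDr gerDl. Qed.
Lemma ramp0 z : 1 <= z -> ramp z = 0.
Proof. by move=> z1; apply/max_l; rewrite ge_min subr_le0 z1 orbT. Qed.

Lemma continuous_ramp : continuous ramp.
Proof.
move=> z.
apply: (@continuous_max R R (fun=> 0) (fun z => Num.min 1 (1 - z))).
  exact: cvg_cst.
apply: (@continuous_min R R (fun=> 1) (fun z => 1 - z)); first exact: cvg_cst.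
by apply: continuousB; [exact: cvg_cst|exact: cvg_id].
Qed.

(** A continuous cut-off between a box and its enlargement by [eta]: weak continuity tests
    continuous functions, and [bump] transfers it to boxes. *)
Definition bump u eta (l : seq (R * R)) (w : cpath u) : R :=
  \prod_(p <- l) ramp ((omega p.1 w - p.2) / eta).
Arguments bump {u}.

Lemma bump01 u eta l (w : cpath u) : 0 <= bump eta l w <= 1.
Proof.
rewrite /bump; elim/big_ind: _; first by rewrite ler01 lexx.
- by move=> x y /andP[? ?] /andP[? ?]; rewrite mulr_ge0// mulr_ile1.
- by move=> t _; rewrite ramp_ge0 ramp_le1.
Qed.
Arguments bump01 {u}.

Lemma bump_ge u eta l (w : pathSpace u) : 0 < eta ->
  \1_(below u l) w <= bump eta l w.
Proof.
move=> e0; rewrite indicE; case: (boolP (w \in _)) => [|_].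
  rewrite inE => wb; rewrite /bump big1_seq//= => p pl.
  by rewrite ramp1// pmulr_lle0 ?invr_gt0// subr_le0 wb.
by have /andP[] := bump01 eta l w.
Qed.

Lemma bump_le u eta l (w : pathSpace u) : 0 < eta ->
  bump eta l w <= \1_(below u (relax eta l)) w.
Proof.
move=> e0; rewrite indicE; case: (boolP (w \in _)) => [_|].
  by have /andP[] := bump01 eta l w.
rewrite notin_setE /= => /existsNP[_] /not_implyP[/mapP[p pl ->] /negP].
rewrite -ltNge/= => pw.
rewrite /bump (big_rem p)//= ramp0 ?mul0r//.
by rewrite ler_pdivlMr// mul1r lerBrDl ltW.
Qed.

Lemma measurable_bump u eta l : {in l, forall p, p.1 \in `[0, u]} ->
  measurable_fun setT (bump eta l : pathSpace u -> R).
Proof.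
elim: l => [_|p l IH lu].
  by rewrite /bump; under eq_fun do rewrite big_nil; exact: measurable_cst.
rewrite /bump; under eq_fun do rewrite big_cons.
apply: measurable_funM; last by apply: IH => q ql; apply: lu; rewrite inE ql orbT.
apply: (@measurableT_comp _ _ _ _ _ _ ramp).
  by apply: continuous_measurable_fun; exact: continuous_ramp.
apply: measurable_funM => //; apply: measurable_funB => //.
by apply: measurable_omega; apply: lu; rewrite mem_head.
Qed.

Lemma continuous_prod_ramp (T : topologicalType) (f : R -> T -> R) eta
    (l : seq (R * R)) :
  {in l, forall p, continuous (f p.1)} ->
  continuous (fun x => \prod_(p <- l) ramp ((f p.1 x - p.2) / eta)).
Proof.
elim: l => [_|p l IH fl].
  by under eq_fun do rewrite big_nil; move=> x; exact: cvg_cst.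
under eq_fun do rewrite big_cons.
move=> x; apply: cvgM; last first.
  by apply: IH => q ql; apply: fl; rewrite inE ql orbT.
apply: (@continuous_comp _ _ _ (fun v => (f p.1 v - p.2) / eta) ramp).
  apply: cvgM; last exact: cvg_cst.
  apply: cvgB; last exact: cvg_cst.
  by apply: fl; rewrite mem_head.
exact: continuous_ramp.
Qed.

Lemma continuous_bump u eta l : {in l, forall p, p.1 \in `[0, u]} ->
  continuous (bump eta l : unifPath u -> R).
Proof.
move=> lu; apply: (@continuous_prod_ramp (unifPath u) (fun t w => omega t w)).
by move=> p pl; apply: continuous_unif_omega; exact: lu.
Qed.

(** Portmanteau argument at y = 0: for small y the integrals of [bump] under [kappa y] and [kappa 0]
    differ by less than [e], and [bump] is caught between the indicators of the two boxes. The
    enlargement by [eta] replaces the condition that the boundary of the box be null. *)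
Lemma weakly_continuous_below u (kappa : R.-pker R ~> pathSpace u) l eta e :
  weakly_continuous kappa -> {in l, forall p, p.1 \in `[0, u]} ->
  0 < eta -> 0 < e ->
  exists2 r : R, 0 < r & forall y, 0 <= y < r ->
    (kappa y (below u l) <= kappa 0%R (below u (relax eta l)) + e%:E)%E /\
    (kappa 0%R (below u l) <= kappa y (below u (relax eta l)) + e%:E)%E.
Proof.
move=> wk lu eta0 e0.
pose F : cpath u -> R := bump eta l.
have Fb : bounded_fun (F : unifPath u -> R).
  exists 1; split=> // M M1 w _ /=; have /andP[w0 w1] := bump01 eta l w.
  by rewrite ger0_norm// (le_trans w1)// ltW.
have := wk F (continuous_bump _ _ _ lu) Fb.
move=> /subspace_continuousP/(_ 0) /=; rewrite in_itv/= lexx => /(_ isT).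
move=> /cvgrPdist_lt/(_ e e0); rewrite near_withinE => /nbhs_ballP[r /= r0 hr].
exists r => // y /andP[y0 yr].
have := hr y; rewrite /ball/= sub0r normrN ger0_norm// => /(_ yr).
rewrite in_itv/= y0 => /(_ isT).
have lu' : {in relax eta l, forall p, p.1 \in `[0, u]}.
  by move=> _ /mapP[p pl ->]; exact: (lu p pl).
have S z := @indic_sandwich _ _ (kappa z) F _ _ (prob_kernel z)
  (measurable_bump _ eta _ lu) (measurable_below _ _ lu)
  (measurable_below _ _ lu')
  (fun w => bump_ge _ _ _ w eta0) (fun w => bump_le _ _ _ w eta0).
have [Sy1 Sy2] := S y; have [S01 S02] := S 0.
rewrite ltr_distl => /andP[h1 h2]; split.
- rewrite (le_trans Sy1)// (le_trans _ (leeD2r _ S02))// -EFinD lee_fin.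
  by rewrite -lerBlDr ltW.
- rewrite (le_trans S01)// (le_trans _ (leeD2r _ Sy2))// -EFinD lee_fin.
  by rewrite ltW.
Qed.

End weak.

(** * The free process near the event w(u) = 0 *)

Lemma path_lt_last {R : realType} (u x : R) (s : seq R) :
  path <%R x s -> last x s < u -> all (< u) (x :: s).
Proof.
elim: s x => [x _ /= ->//|a s IH x /= /andP[xa ps] su].
by have /= /andP[au ->] := IH a ps su; rewrite au (lt_trans xa).
Qed.
Arguments path_lt_last {R u x s}.

Section bessel_process.
Context {R : realType}.
Variables (delta u : R) (P : probability (pathSpace u) R).
Hypotheses (u0 : 0 < u) (lawP : bessel_law delta 0 P).
Implicit Types (l : seq (R * R)) (lam k r t : R) (B : set R).

Definition levels (l : seq (R * R)) : seq (R * set R) :=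
  [seq (p.1, `]-oo, p.2]%classic) | p <- l].

Lemma levels_path l B : path <%R 0 (unzip1 l) -> all (< u) (unzip1 l) ->
  path <%R 0 (unzip1 (rcons (levels l) (u, B))).
Proof.
move=> pl lu; rewrite /unzip1 map_rcons -map_comp rcons_path.
rewrite (_ : [seq _ | _ <- l] = unzip1 l)// pl/=.
have /allP lu' : all (< u) (0 :: unzip1 l) by rewrite /= u0.
exact: lu' (mem_last _ _).
Qed.

Lemma bessel_law_below l B : path <%R 0 (unzip1 l) -> all (< u) (unzip1 l) ->
  measurable B ->
  P (below u l `&` omega u @^-1` B) =
  bessel_fdd delta 0 0 (rcons (levels l) (u, B)).
Proof.
move=> pl lu mB; rewrite -lawP.2.
- congr (P _); apply/seteqP; split => w /=.
    move=> [wl wB] tB; rewrite mem_rcons inE => /predU1P[->//|/mapP[p pl' ->]/=].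
    by rewrite in_itv/= wl.
  move=> H; split => [p pl'|].
    have /= := H (p.1, `]-oo, p.2]%classic).
    rewrite in_itv/=; apply; rewrite mem_rcons inE; apply/orP; right.
    by apply/mapP; exists p.
  by apply: (H (u, B)); rewrite mem_rcons mem_head.
- exact: levels_path.
- move=> tB; rewrite mem_rcons inE => /predU1P[->//|/mapP[p pl' ->]/=].
  by split => //; apply/ltW/(allP lu)/map_f.
Qed.

Definition bridge_slope lam := (lam^-1 - lam) / u.

Lemma affine_slope lam t : 0 < lam -> 0 <= t <= u -> 0 < lam + bridge_slope lam * t.
Proof.
move=> l0 /andP[t0 tu].
(* g(t) is the convex combination of its end values [lam] and [lam^-1]. *)
have -> : lam + bridge_slope lam * t = (lam * (u - t) + lam^-1 * t) / u.
  by rewrite /bridge_slope; field; rewrite !gt_eqF.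
rewrite divr_gt0//; move: t0; rewrite le_eqVlt => /predU1P[<-|t0].
  by rewrite subr0 mulr0 addr0 mulr_gt0.
by rewrite ltr_wpDl ?mulr_gt0 ?invr_gt0// mulr_ge0 ?(ltW l0)// subr_ge0.
Qed.

Lemma affine_slope_end lam : lam + bridge_slope lam * u = lam^-1.
Proof. by rewrite /bridge_slope divfK ?gt_eqF// addrC subrK. Qed.

Lemma clock_end lam : 0 < lam -> clock lam (bridge_slope lam) u = u.
Proof. by move=> l0; rewrite /clock affine_slope_end mulfV ?gt_eqF// divr1. Qed.

Lemma clock0 lam k : clock lam k 0 = 0. Proof. by rewrite /clock mul0r. Qed.

Lemma bridge_slopeV lam : bridge_slope lam^-1 = - bridge_slope lam.
Proof. by rewrite /bridge_slope invrK -mulNr opprB. Qed.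

(** The box in which w must lie for the transformed path g(t) w(theta(t)) to lie in the box [l]. *)
Definition transport lam l : seq (R * R) :=
  [seq (clock lam (bridge_slope lam) p.1,
        p.2 / (lam + bridge_slope lam * p.1)) | p <- l].

(* An upper bound of h(u, y)/h(0, 0) for 0 <= y < r. *)
Definition distortion lam r :=
  lam^-1 `^ (- (delta / 2)) / lam `^ (- (delta / 2)) *
    expR (`|bridge_slope lam| * lam * r ^+ 2 / 2).

Lemma distortion_gt0 lam r : 0 < lam -> 0 < distortion lam r.
Proof. by move=> l0; rewrite mulr_gt0 ?divr_gt0 ?powR_gt0 ?expR_gt0 ?invr_gt0. Qed.

(** The powers of [lam] cancel, so the product tends to 1 as r -> 0: transporting by [lam] and back
    by [lam^-1] costs nothing in the limit. *)
Lemma distortionV lam r : 0 < lam ->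
  distortion lam r * distortion lam^-1 (lam * r) =
  expR (`|bridge_slope lam| * lam * r ^+ 2).
Proof.
move=> l0; rewrite /distortion invrK bridge_slopeV normrN.
set A := _ `^ _; set B := lam `^ _.
rewrite mulrACA (_ : A / B * (B / A) = 1) ?mul1r; last first.
  by field; rewrite !gt_eqF ?powR_gt0 ?invr_gt0.
by rewrite -expRD; congr expR; field; rewrite gt_eqF.
Qed.

Lemma levels_slope lam l B : 0 < lam -> path <%R 0 (unzip1 l) ->
  all (< u) (unzip1 l) ->
  forall t, t \in 0 :: unzip1 (rcons (levels l) (u, B)) ->
    0 < lam + bridge_slope lam * t.
Proof.
move=> l0 pl lu t tl; apply: affine_slope => //.
have pU := levels_path l B pl lu.
move: tl; rewrite inE => /predU1P[->|tl]; first by rewrite lexx ltW.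
have t0 : 0 < t by apply: (allP (order_path_min lt_trans pU)).
rewrite ltW//=; move: tl; rewrite /unzip1 map_rcons mem_rcons inE => /predU1P[->//|].
by rewrite -map_comp => /(allP lu)/ltW.
Qed.

Lemma transport_path lam l : 0 < lam -> path <%R 0 (unzip1 l) ->
  all (< u) (unzip1 l) ->
  path <%R 0 (unzip1 (transport lam l)) /\ all (< u) (unzip1 (transport lam l)).
Proof.
move=> l0 pl lu.
have := @clock_path _ lam (bridge_slope lam) 0 _ l0
  (levels_path l setT pl lu) (levels_slope _ l setT l0 pl lu).
rewrite map_rcons clock0 {1}/unzip1 map_rcons rcons_path /= clock_end//.
have -> : [seq i.1 | i <- map (moebius_event lam (bridge_slope lam)) (levels l)] =
    unzip1 (transport lam l) by rewrite /unzip1 -!map_comp.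
move=> /andP[pt lt]; split => //.
by have /andP[] := path_lt_last pt lt.
Qed.

(** [bessel_fdd_moebius] started at time 0 from 0, with the end event as last entry. Since theta(u)
    = u and g(u) = [lam^-1], the transformed path ends in [0, r[ exactly when w(u) lies in [0,
    [lam * r][. *)
Lemma bessel_law_transport lam r l : 0 < lam -> 0 < r ->
  path <%R 0 (unzip1 l) -> all (< u) (unzip1 l) ->
  (P (below u (transport lam l) `&` omega u @^-1` `[0%R, (lam * r)%R[) <=
   (distortion lam r)%:E * P (below u l `&` omega u @^-1` `[0%R, r[))%E.
Proof.
move=> l0 r0 pl lu; have [ptr ltr] := transport_path lam l l0 pl lu.
set k := bridge_slope lam.
rewrite !bessel_law_below//.
have -> : rcons (levels (transport lam l)) (u, `[0, lam * r[%classic) =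
    map (moebius_event lam k) (rcons (levels l) (u, `[0, r[%classic)).
  rewrite map_rcons; congr rcons; last first.
    rewrite /moebius_event/= clock_end// affine_slope_end; congr pair.
    apply/seteqP; split => y /=; rewrite !in_itv/= pmulr_rge0 ?invr_gt0//;
    by rewrite -ltr_pdivlMl ?invr_gt0// invrK.
  rewrite /levels /transport -!map_comp; apply/eq_in_map => p pl' /=.
  rewrite /moebius_event/=; congr pair.
  have g0 : 0 < lam + k * p.1.
    apply: (levels_slope lam l setT) => //.
    rewrite inE /unzip1 map_rcons mem_rcons inE; apply/orP; right; apply/orP; right.
    by rewrite -map_comp; apply/mapP; exists p.
  by apply/seteqP; split => y /=; rewrite !in_itv/= ler_pdivlMr// mulrC.
pose M := lam^-1 `^ (- (delta / 2)) * expR (`|k| * lam * r ^+ 2 / 2).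
have M0 : 0 < M by rewrite mulr_gt0 ?powR_gt0 ?expR_gt0 ?invr_gt0.
have := @bessel_fdd_moebius _ delta lam k M 0 0 _ l0
  (levels_path l `[0, r[%classic pl lu) (levels_slope lam l _ l0 pl lu) (lexx 0) M0.
rewrite last_rcons clock0 mulr0 !addr0 mulr0 affine_slope_end.
have -> : M / bessel_h delta k lam 0 = distortion lam r.
  by rewrite /bessel_h /M /distortion expr0n/= mulr0 mul0r expR0 mulr1 mulrAC.
apply => y y0; rewrite /= in_itv/= => /andP[_ yr].
rewrite /bessel_h ler_pM2l ?powR_gt0 ?invr_gt0// ler_expR invfM invrK.
rewrite (_ : _ / 2 = `|k| * r ^+ 2 * (2^-1 * lam)); last by ring.
rewrite ler_wpM2r ?mulr_ge0 ?(ltW l0)//.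
apply: (@le_trans _ _ (`|k| * y ^+ 2)).
  by rewrite ler_wpM2r ?exprn_ge0// ler_norm.
by rewrite ler_wpM2l// lerXn2r ?nnegrE ?(ltW r0)// ltW.
Qed.

Lemma bessel_law_end B : measurable B ->
  P (omega u @^-1` B) =
  (\int[lebesgue_measure]_(y in B `&` `[0%R, +oo[) (bessel_density delta u 0 y)%:E)%E.
Proof.
move=> mB; have := bessel_law_below [::] B isT isT mB.
rewrite below_nil setTI => ->/=; rewrite subr0.
by apply: eq_integral => y _; rewrite mule1.
Qed.

(** For [c >= 1] the Gaussian factor can only decrease, so the power of y alone accounts for the
    constant. *)
Lemma bessel_density0_scale c y : 1 <= c -> 0 <= y ->
  bessel_density delta u 0 (c * y) <=
  c `^ (2 * (delta / 2 - 1) + 1) * bessel_density delta u 0 y.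
Proof.
move=> c1 y0; have c0 : 0 <= c by rewrite (le_trans _ c1).
have exp_le : expR (- ((c * y) ^+ 2 / (2 * u))) <= expR (- (y ^+ 2 / (2 * u))).
  rewrite ler_expR lerN2 ler_pM2r ?invr_gt0 ?mulr_gt0//.
  by rewrite exprMn ler_peMl ?exprn_ge0// exprn_ege1.
rewrite /bessel_density/= eqxx powRM// -2!(mulrA (c `^ _)).
rewrite ler_wpM2l ?powR_ge0// ler_wpM2r//.
  by rewrite invr_ge0 !mulr_ge0 ?powR_ge0 ?Gamma_ge0.
by rewrite ler_wpM2l// powR_ge0.
Qed.

(* Total mass 1 excludes the junk value Gamma (delta / 2) = 0, for which the
   density would vanish; scaling then moves the mass close to 0. *)
Lemma bessel_law_end_gt0 r : 0 < r -> (0 < P (omega u @^-1` `[0%R, r[))%E.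
Proof.
move=> r0; rewrite lt0e measure_ge0 andbT; apply/eqP => P0.
have mo B : measurable B -> measurable (omega u @^-1` B : set (pathSpace u)).
  by apply: measurable_omega_preimage; rewrite in_itv/= lexx ltW.
have Pn n : (P (omega u @^-1` `[0%R, n%:R[) = 0)%E.
  (* Scaling by this [c] carries [0, r[ onto an interval containing [0, n[, which is therefore null
     too. *)
  pose c : R := Num.max 1 (n%:R / r).
  have c1 : 1 <= c by rewrite le_max lexx.
  have c0 : 0 < c by rewrite (lt_le_trans _ c1).
  apply/eqP; rewrite eq_le measure_ge0 andbT.
  have nc : n%:R <= c * r by rewrite -ler_pdivrMr// le_max lexx orbT.
  apply: (@le_trans _ _ (P (omega u @^-1` `[0%R, (c * r)%R[))).
    apply: le_measure; rewrite ?inE; try exact: mo.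
    by move=> w /=; rewrite !in_itv/= => /andP[-> /lt_le_trans]; exact.
  rewrite -(mule0 (c `^ (2 * (delta / 2 - 1) + 1) / c^-1)%:E) -P0 !bessel_law_end//.
  have -> : `[0, (c * r)[ `&` `[0, +oo[ = *%R c^-1 @^-1` (`[0, r[ `&` `[0, +oo[).
    apply/seteqP; split => y /=; rewrite !in_itv/= !andbT !pmulr_rge0 ?invr_gt0//;
    by rewrite -ltr_pdivlMl ?invr_gt0// invrK.
  apply: integral_le_scale; rewrite ?powR_gt0 ?invr_gt0//.
  - move=> y [_] /=; rewrite in_itv/= andbT pmulr_rge0 ?invr_gt0// => y0.
    by rewrite lee_fin bessel_density_ge0// ltW.
  - move=> y [_] /=; rewrite in_itv/= andbT => y0.
    by rewrite lee_fin bessel_density_ge0// ltW.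
  - move=> y [_] /=; rewrite in_itv/= andbT => y0.
    rewrite -EFinM lee_fin (le_trans _ (bessel_density0_scale _ _ c1 y0))//.
    by rewrite mulrA mulfV ?gt_eqF// mul1r.
(* [bessel_fdd] integrates over nonnegative parts only, so the half-line has the mass of the whole
   space. *)
have P1 : P (omega u @^-1` `[0%R, +oo[) = 1%E.
  rewrite -(@probability_setT _ _ _ P) (_ : [set: pathSpace u] = omega u @^-1` setT)//.
  by rewrite !bessel_law_end// setTI setIid.
have cov : omega u @^-1` `[0, +oo[ =
    \bigcup_n omega u @^-1` `[0, n%:R[ :> set (pathSpace u).
  apply/seteqP; split => [w|w [n _]] /=; rewrite !in_itv/= ?andbT; last by case/andP.
  by move=> w0; exists (Num.bound (omega u w)) => //=; rewrite in_itv/= w0 archi_boundP.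
have : P.-negligible (omega u @^-1` `[0%R, +oo[).
  rewrite cov; apply: negligible_bigcup => n.
  by apply/negligibleP; [exact: mo|exact: Pn].
move=> /(proj1 (negligibleP P (mo _ (measurable_itv _))))/eqP.
by rewrite -[X in X == _]/(P (omega u @^-1` `[0, +oo[)) P1 onee_eq0.
Qed.

End bessel_process.

(** * Invariance of the bridge *)

Section disintegration.
Context {R : realType} (u : R) (P : probability (pathSpace u) R)
  (kappa : R.-pker R ~> pathSpace u).
Hypotheses (u0 : 0 < u) (rk : regular_conditional_law P kappa).
Variables (A : set (pathSpace u)) (B : set R) (q : R).
Hypotheses (mA : measurable A) (mB : measurable B).

Let moB : measurable (omega u @^-1` B : set (pathSpace u)).
Proof.
by apply: measurable_omega_preimage => //; rewrite in_itv/= lexx ltW.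
Qed.

Let mk : measurable_fun (omega u @^-1` B : set (pathSpace u))
  (fun w => kappa (omega u w) A).
Proof.
apply: measurable_funTS; apply: (@measurableT_comp _ _ _ _ _ _ (kappa ^~ A)).
  exact: measurable_kernel.
by apply: measurable_omega; rewrite in_itv/= lexx ltW.
Qed.

Lemma conditional_le : (forall y, B y -> kappa y A <= q%:E)%E ->
  (P (A `&` omega u @^-1` B) <= q%:E * P (omega u @^-1` B))%E.
Proof.
move=> kq; rewrite rk// -integral_cst//.
by apply: ge0_le_integral => // w Bw; rewrite ?lee_fin//; exact: kq.
Qed.

Lemma conditional_ge : 0 <= q -> (forall y, B y -> q%:E <= kappa y A)%E ->
  (q%:E * P (omega u @^-1` B) <= P (A `&` omega u @^-1` B))%E.
Proof.
move=> q0 kq; rewrite rk// -integral_cst//.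
by apply: ge0_le_integral => // w Bw; rewrite ?lee_fin//; exact: kq.
Qed.

End disintegration.

(** * Comparison of boxes under the bridge law *)

Section bridge.
Context {R : realType} (delta u lam : R) (Q : probability (pathSpace u) R).
Hypotheses (u0 : 0 < u) (l0 : 0 < lam) (bQ : bessel_bridge_law delta 0 u 0 Q).
Implicit Types (l : seq (R * R)).
Local Notation g t := (lam + bridge_slope u lam * t).

Lemma times_in l : path <%R 0 (unzip1 l) -> all (< u) (unzip1 l) ->
  {in l, forall p, p.1 \in `[0, u]}.
Proof.
move=> pl lu p pl'; have p1 : p.1 \in unzip1 l by apply/mapP; exists p.
rewrite in_itv/= !ltW//; first exact: (allP lu).
exact: (allP (order_path_min lt_trans pl)).
Qed.

Lemma slope_le t : t \in `[0, u] -> g t <= lam + lam^-1.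
Proof.
rewrite in_itv/= => /andP[t0 tu].
rewrite -subr_ge0 (_ : _ - _ = (lam^-1 * (u - t) + lam * t) / u); last first.
  by rewrite /bridge_slope; field; rewrite !gt_eqF.
by rewrite divr_ge0 ?(ltW u0)// addr_ge0// mulr_ge0 ?invr_ge0 ?(ltW l0)// subr_ge0.
Qed.

Lemma exists_radius (a b k e : R) : 0 < a -> 0 < b -> 0 <= k -> 0 < e ->
  exists r, [/\ 0 < r, r <= a, r <= b & expR (k * r ^+ 2) <= 1 + e].
Proof.
move=> a0 b0 k0 e0; have L0 : 0 < ln (1 + e) by rewrite ln_gt0// ltrDl.
(* As r <= 1, k r^2 <= (k + 1) r <= ln (1 + e); the added 1 keeps the denominator positive when k =
   0. *)
pose r := Num.min (Num.min a b) (Num.min 1 (ln (1 + e) / (k + 1))).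
have k1 : 0 < k + 1 by rewrite ltr_wpDl.
have r0 : 0 < r by rewrite /r !lt_min a0 b0 ltr01 divr_gt0.
have r1 : r <= 1 by rewrite /r !ge_min lexx orbT.
exists r; split => //.
- by rewrite /r !ge_min lexx.
- by rewrite /r !ge_min lexx orbT.
rewrite -[leRHS]lnK ?posrE ?addr_gt0// ler_expR.
have : r <= ln (1 + e) / (k + 1) by rewrite /r !ge_min lexx !orbT.
rewrite ler_pdivlMr// => /(le_trans _); apply.
rewrite mulrC expr2 -mulrA ler_pM2l//.
by rewrite (le_trans _ (_ : k <= _))// ?lerDl// -[leRHS]mul1r ler_wpM2r.
Qed.

(** Conditioning on w(u) near 0. Weak continuity bounds the [kappa y]-probability of the enlarged
    transported box below by [q1 - e], and that of the raised box [l1] above by [q2 + e], for small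
    y. Integrating over the end value and transporting by [lam] link the two. Transporting by
    [lam^-1] with no constraint before time u brings back the event w(u) < [lam * r], whose positive
    probability cancels; the product of the distortions is at most 1 + e. *)
Lemma transport_le_relax l eta : path <%R 0 (unzip1 l) -> all (< u) (unzip1 l) ->
  0 < eta ->
  (Q (below u (transport u lam l)) <=
   Q (below u (relax eta [seq (p.1, p.2 + g p.1 * eta)%R | p <- l])))%E.
Proof.
move=> pl lu eta0; have [P [kappa [lawP rk wk kQ]]] := bQ.
set l1 := [seq _ | p <- l].
have l1E : unzip1 l1 = unzip1 l by rewrite /unzip1 -map_comp.
have pl1 : path <%R 0 (unzip1 l1) by rewrite l1E.
have lu1 : all (< u) (unzip1 l1) by rewrite l1E.
have [plT luT] := transport_path u u0 lam l l0 pl lu.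
(* Raising the transported levels by [eta] amounts to raising the original ones by g(t) [eta]. *)
have OE : relax eta (transport u lam l) = transport u lam l1.
  rewrite /relax /transport -!map_comp; apply/eq_in_map => p /(times_in _ pl lu) pu /=.
  congr pair; have g0 : 0 < g p.1 by apply: affine_slope => //; rewrite in_itv in pu.
  by field; rewrite gt_eqF.
have tT := times_in _ plT luT; have t1 := times_in _ pl1 lu1.
have [plT1 luT1] := transport_path u u0 lam l1 l0 pl1 lu1.
have tT1 := times_in _ plT1 luT1.
have t2 : {in relax eta l1, forall p, p.1 \in `[0, u]}.
  by move=> _ /mapP[p pl' ->]; exact: (t1 p pl').
have mb l' : {in l', forall p, p.1 \in `[0, u]} -> measurable (below u l').
  exact: measurable_below.
set q1 := fine (Q (below u (transport u lam l))).
set q2 := fine (Q (below u (relax eta l1))).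
have q1E : Q (below u (transport u lam l)) = q1%:E.
  by rewrite fineK// fin_num_measure//; exact: mb.
have q2E : Q (below u (relax eta l1)) = q2%:E.
  by rewrite fineK// fin_num_measure//; exact: mb.
(* The chain below yields q1 - e <= (1 + e)(q2 + e), and both q2 and e are at most 1, whence 4 e. *)
suff H e : 0 < e -> e <= 1 -> q1 <= q2 + 4 * e.
  rewrite q1E q2E lee_fin; apply/ler_addgt0Pr => e e0.
  have m0 : 0 < Num.min 1 (e / 4) by rewrite lt_min ltr01 divr_gt0.
  rewrite (le_trans (H _ m0 _))// ?lerD2l ?ge_min ?lexx//.
  by rewrite -ler_pdivlMl// mulrC ge_min lexx orbT.
move=> e0 e1.
have [r1 r10 hr1] := weakly_continuous_below u kappa _ eta e wk tT eta0 e0.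
have [r2 r20 hr2] := weakly_continuous_below u kappa _ eta e wk t1 eta0 e0.
have [r [r0 rr1 rr2 Er]] := @exists_radius (r1 / lam) r2 (`|bridge_slope u lam| * lam) e
   (divr_gt0 r10 l0) r20 (mulr_ge0 (normr_ge0 _) (ltW l0)) e0.
have lr0 : 0 < lam * r by rewrite mulr_gt0.
(* Truncated at 0 because [conditional_ge] takes a nonnegative constant. *)
pose q := Num.max 0 (q1 - e).
pose ev s : set (pathSpace u) := omega u @^-1` `[0%R, s[.
have q0 : 0 <= q by rewrite le_max lexx.
have I1 : (q%:E * P (ev (lam * r)%R) <=
    P (below u (transport u lam l1) `&` ev (lam * r)%R))%E.
  apply: (@conditional_ge _ _ _ kappa) => //; first exact: mb.
  move=> y /=; rewrite in_itv/= => /andP[y0 yr].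
  have [|_] := hr1 y; first by rewrite y0 (lt_le_trans yr)// mulrC -ler_pdivlMr.
  rewrite -OE -kQ; last exact: mb.
  rewrite q1E -leeBlDr// => h; rewrite /q EFin_max ge_max h.
  by rewrite measure_ge0.
have I2 := bessel_law_transport delta u P u0 lawP lam r l1 l0 r0 pl1 lu1.
have q20 : 0 <= q2 by rewrite fine_ge0.
have q21 : q2 <= 1 by rewrite -lee_fin -q2E probability_le1//; exact: mb.
have qe0 : 0 <= q2 + e by rewrite addr_ge0// ltW.
have I3 : (P (below u l1 `&` ev r) <= (q2 + e)%:E * P (ev r))%E.
  apply: (conditional_le u P kappa u0 rk _ _ _ (mb _ t1) (measurable_itv _)).
  move=> y /=; rewrite in_itv/= => /andP[y0 yr].
  have [|+ _] := hr2 y; first by rewrite y0 (lt_le_trans yr).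
  by rewrite -kQ ?EFinD; [rewrite q2E|exact: mb].
have li0 : 0 < lam^-1 by rewrite invr_gt0.
have I4 : (P (ev r) <= (distortion delta u lam^-1 (lam * r))%:E * P (ev (lam * r)%R))%E.
  have := bessel_law_transport delta u P u0 lawP lam^-1 (lam * r) [::] li0 lr0 isT isT.
  by rewrite mulrA mulVf ?gt_eqF// mul1r below_nil !setTI.
have p0 := bessel_law_end_gt0 delta u P u0 lawP _ lr0; rewrite -/(ev _) in p0.
have mev s : measurable (ev s).
  by apply: measurable_omega_preimage => //; rewrite in_itv/= lexx ltW.
have fp : P (ev (lam * r)) = (fine (P (ev (lam * r))))%:E.
  by rewrite fineK// fin_num_measure.
have K0 := distortion_gt0 delta u lam r l0.
have : (q%:E * P (ev (lam * r)%R) <= (distortion delta u lam r)%:E * ((q2 + e)%:E *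
    ((distortion delta u lam^-1 (lam * r))%:E * P (ev (lam * r)%R))))%E.
  rewrite (le_trans I1)// (le_trans I2)// lee_pmul2l ?lte_fin//.
  by rewrite (le_trans I3)// lee_wpmul2l// lee_fin addr_ge0// ltW.
rewrite fp lte_fin in p0 *; rewrite -!EFinM lee_fin.
have -> : distortion delta u lam r * ((q2 + e) * (distortion delta u lam^-1 (lam * r) *
    fine (P (ev (lam * r))))) =
    distortion delta u lam r * distortion delta u lam^-1 (lam * r) * (q2 + e) *
    fine (P (ev (lam * r))) by ring.
rewrite distortionV// ler_pM2r// => h.
have {}h : q <= (1 + e) * (q2 + e).
  by rewrite (le_trans h)// ler_wpM2r// addr_ge0// ltW.
have : q1 - e <= q by rewrite /q le_max lexx orbT.
have : e * q2 <= e by rewrite ler_piMr// ltW.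
have : e * e <= e by rewrite ler_piMr// ltW.
move: h; lra.
Qed.

(** On [0, u], g is at most [lam + lam^-1], so this choice of [eta] keeps the total enlargement g(t)
    [eta] + [eta] below [eps]. *)
Lemma transport_le l eps : path <%R 0 (unzip1 l) -> all (< u) (unzip1 l) ->
  0 < eps ->
  (Q (below u (transport u lam l)) <= Q (below u (relax eps l)))%E.
Proof.
move=> pl lu e0.
have G0 : 0 < lam + lam^-1 + 1 by rewrite !addr_gt0 ?invr_gt0.
pose eta := eps / (lam + lam^-1 + 1).
have eta0 : 0 < eta by rewrite divr_gt0.
apply: (le_trans (transport_le_relax l eta pl lu eta0)).
have lu' := times_in _ pl lu.
apply: le_measure; rewrite ?inE.
- by apply: measurable_below => _ /mapP[_ /mapP[p pl' ->] ->]; exact: (lu' p pl').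
- by apply: measurable_below => _ /mapP[p pl' ->]; exact: (lu' p pl').
move=> w wl _ /mapP[p pl' ->] /=.
have := wl (p.1, p.2 + g p.1 * eta + eta).
rewrite /relax -map_comp => /(_ (map_f _ pl'))/= h; apply: (le_trans h).
rewrite -addrA lerD2l -[X in _ + X]mul1r -mulrDl /eta mulrCA ger_pMr//.
by rewrite ler_pdivrMr// mul1r lerD2r slope_le// lu'.
Qed.

End bridge.

(** * Suprema of paths *)

Section barrier.
Context {R : realType} (u : R).
Hypothesis u0 : 0 < u.
Implicit Types (b c d t : R) (w : pathSpace u).

Definition rat_point (j : nat) : R := ratr (odflt 0 (unpickle j : option rat)).

(** Sorted without repetition because finite-dimensional laws take strictly increasing times. The
    end points are left out: time u carries the conditioning event, and 0 is also the default value
    of [rat_point]. Continuity of paths recovers them. *)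
Definition rat_times (i : nat) : seq R :=
  sort <=%R (undup [seq t <- map rat_point (iota 0 i) | 0 < t < u]).

Lemma mem_rat_times i t : (t \in rat_times i) =
  (0 < t < u) && (t \in map rat_point (iota 0 i)).
Proof. by rewrite mem_sort mem_undup mem_filter. Qed.

Lemma rat_times_path i : path <%R 0 (rat_times i).
Proof.
rewrite path_min_sorted; last first.
  by apply/allP => t; rewrite mem_rat_times => /andP[/andP[]].
by rewrite lt_sorted_uniq_le sort_uniq undup_uniq sort_le_sorted.
Qed.

Lemma rat_times_lt i : all (< u) (rat_times i).
Proof. by apply/allP => t; rewrite mem_rat_times => /andP[/andP[]]. Qed.

Lemma rat_times_in i t : t \in rat_times i -> t \in `[0, u].
Proof.
by rewrite mem_rat_times in_itv/= => /andP[/andP[/ltW -> /ltW ->]].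
Qed.

Lemma rat_times_sub i j : (i <= j)%N -> {subset rat_times i <= rat_times j}.
Proof.
move=> ij t; rewrite !mem_rat_times => /andP[-> /mapP[k ki ->]] /=.
by apply: map_f; rewrite !mem_iota/= !add0n in ki *; exact: leq_trans ij.
Qed.

Definition tilt_le b d : set (pathSpace u) :=
  [set w | forall t, t \in `[0, u] -> omega t w + b * t <= d].

Definition sup_tilt_lt b c : set (pathSpace u) :=
  [set w | sup [set omega t w + b * t | t in `[0, u]] < c].

Lemma continuous_tilt b w : {within `[0, u], continuous (fun t => omega t w + b * t)}.
Proof.
move=> t; apply: cvgD; first exact: within_continuous_omega.
apply: cvgM; first exact: cvg_cst.
exact: (@continuous_subspaceT _ _ `[0, u] id (fun x => cvg_id)).
Qed.

(** By continuity, a violation at any time of [0, u] persists at a nearby rational time of ]0,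
    u[. *)
Lemma tilt_le_rat b d w :
  (forall i t, t \in rat_times i -> omega t w + b * t <= d) -> tilt_le b d w.
Proof.
move=> H t; rewrite in_itv/= => /andP[t0 tu]; rewrite leNgt; apply/negP => dt.
have := continuous_tilt b w; move=> /subspace_continuousP/(_ t).
rewrite /= in_itv/= t0 tu => /(_ isT)/cvgrPdist_lt/(_ (omega t w + b * t - d)).
rewrite subr_gt0 dt => /(_ isT); rewrite near_withinE => /nbhs_ballP[e /= e0 he].
(* The neighbourhood of t meets ]0, u[ even when t is an end point. *)
have itv : Num.max 0 (t - e) < Num.min u (t + e).
  rewrite gt_max !lt_min u0 ltr_wpDl//=; apply/andP; split.
    by rewrite ltrBlDr (le_lt_trans tu)// ltrDl.
  by rewrite ltrBlDr -addrA ltrDl addr_gt0.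
have [q] := rat_in_itvoo itv.
rewrite in_itv/= gt_max lt_min => /andP[/andP[q0 tq] /andP[qu qt]].
have /he : ball t e (ratr q) by rewrite /ball/= ltr_distlC; lra.
rewrite in_itv/= (ltW q0) (ltW qu) => /(_ isT); rewrite ltr_distl => /andP[_].
have Hq : omega (ratr q) w + b * ratr q <= d.
  apply: (H (pickle q).+1); rewrite mem_rat_times q0 qu.
  apply/mapP; exists (pickle q); first by rewrite mem_iota/= add0n.
  by rewrite /rat_point pickleK.
rewrite /from_subspace; lra.
Qed.

(** The supremum is attained on the compact interval, so a strict bound leaves a margin 1/(n +
    1). *)
Lemma sup_tilt_ltE b c : sup_tilt_lt b c = \bigcup_n tilt_le b (c - n.+1%:R^-1).
Proof.
apply/seteqP; split => [w /= supc|w [n _] /= h].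
  have [s su smax] := EVT_max (ltW u0) (continuous_tilt b w).
  have sc : omega s w + b * s < c.
    apply: le_lt_trans supc; apply: sup_upper_bound; last by exists s.
    split; first by exists (omega s w + b * s), s.
    by exists (omega s w + b * s) => _ [t tu <-]; exact: smax.
  have [n hn] := ltr_add_invr sc; exists n => // t tu.
  by rewrite (le_trans (smax t tu))// lerBrDr ltW.
apply: (@le_lt_trans _ _ (c - n.+1%:R^-1)); last by rewrite gtrBl invr_gt0.
apply: ge_sup; last by move=> _ [t tu <-]; exact: h.
by exists (omega 0 w + b * 0), 0 => //=; rewrite in_itv/= lexx ltW.
Qed.

Definition tilted_levels i b d : seq (R * R) := [seq (t, d - b * t) | t <- rat_times i].

Lemma tilted_levels_in i b d : {in tilted_levels i b d, forall p, p.1 \in `[0, u]}.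
Proof. by move=> _ /mapP[t ti ->]; exact: (rat_times_in _ _ ti). Qed.

Lemma tilt_leE b d : tilt_le b d = \bigcap_i below u (tilted_levels i b d).
Proof.
apply/seteqP; split => [w h i _ _ /mapP[t ti ->]|w h] /=.
  by rewrite lerBrDr h// (rat_times_in i).
apply: tilt_le_rat => i t ti; rewrite -lerBrDr.
by have /= := h i I (t, d - b * t) (map_f _ ti).
Qed.

Lemma measurable_tilt_le b d : measurable (tilt_le b d).
Proof.
rewrite tilt_leE; apply: bigcapT_measurable => i.
by apply: measurable_below; exact: tilted_levels_in.
Qed.

Lemma measurable_sup_tilt_lt b c : measurable (sup_tilt_lt b c).
Proof.
rewrite sup_tilt_ltE; apply: bigcupT_measurable => n; exact: measurable_tilt_le.
Qed.

Lemma tilted_levels_nonincreasing b d :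
  nonincreasing_seq (fun i => below u (tilted_levels i b d)).
Proof.
move=> i j ij; apply/subsetPset => w h _ /mapP[t ti ->].
by apply: h; apply: map_f; exact: rat_times_sub ti.
Qed.

Lemma tilt_le_nondecreasing b c :
  nondecreasing_seq (fun n => tilt_le b (c - n.+1%:R^-1)).
Proof.
move=> i j ij; apply/subsetPset => w h t tu; rewrite (le_trans (h t tu))//.
by rewrite lerD2l lerN2 lef_pV2 ?posrE// ler_nat.
Qed.

(** Continuity from above along the decreasing boxes at rational times. *)
Lemma le_measure_tilt_le (Q : probability (pathSpace u) R) x b d :
  (forall i, x <= Q (below u (tilted_levels i b d)))%E -> (x <= Q (tilt_le b d))%E.
Proof.
move=> h; rewrite tilt_leE.
have := @nonincreasing_cvg_mu _ _ _ Q (fun i => below u (tilted_levels i b d)).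
have m i : measurable (below u (tilted_levels i b d)).
  by apply: measurable_below; exact: tilted_levels_in.
move=> /(_ _ m _ (tilted_levels_nonincreasing b d)) cv.
have {}cv := cv _ (bigcapT_measurable m).
rewrite -(cvg_lim _ (cv _))//; last by rewrite -ge0_fin_numE// fin_num_measure.
apply: lime_ge; last by apply: nearW => i; exact: h.
by apply/cvg_ex; eexists; apply: cv; rewrite -ge0_fin_numE// fin_num_measure.
Qed.

(** Continuity from below, through the increasing union of [sup_tilt_ltE]. *)
Lemma measure_sup_tilt_lt_le (Q : probability (pathSpace u) R) x b c :
  (forall d, (d < c)%R -> Q (tilt_le b d) <= x)%E -> (Q (sup_tilt_lt b c) <= x)%E.
Proof.
move=> h; rewrite sup_tilt_ltE.
have := @nondecreasing_cvg_mu _ _ _ Q (fun n => tilt_le b (c - n.+1%:R^-1)).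
have m n : measurable (tilt_le b (c - n.+1%:R^-1)) by exact: measurable_tilt_le.
move=> /(_ m (bigcupT_measurable _ m) (tilt_le_nondecreasing b c)) cv.
rewrite -(cvg_lim _ cv)//.
apply: lime_le; last by apply: nearW => n; apply: h; rewrite gtrBl invr_gt0.
by apply/cvg_ex; eexists; exact: cv.
Qed.

End barrier.

(* The new barrier is g(t) (c - b theta(t)) = c lam - (b/lam - c k) t. *)
Lemma sup_tilt_lt_transport (R : realType) (delta u lam b c : R)
    (Q : probability (pathSpace u) R) :
  0 < u -> 0 < lam -> bessel_bridge_law delta 0 u 0 Q ->
  (Q (sup_tilt_lt u b c) <=
   Q (sup_tilt_lt u (b / lam - c * bridge_slope u lam)%R (c * lam)%R))%E.
Proof.
move=> u0 l0 bQ; set k := bridge_slope u lam; set b' := b / lam - c * k.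
apply: measure_sup_tilt_lt_le => // d dc.
(* The minimum of the affine function g on [0, u], attained at an end point. *)
pose m := Num.min lam lam^-1.
have m0 : 0 < m by rewrite lt_min l0 invr_gt0.
have mk t : t \in `[0, u] -> m <= lam + k * t.
  rewrite in_itv/= => /andP[t0 tu]; rewrite -subr_ge0.
  have -> : lam + k * t - m = ((lam - m) * (u - t) + (lam^-1 - m) * t) / u.
    by rewrite /k /bridge_slope; field; rewrite !gt_eqF.
  by rewrite divr_ge0 ?(ltW u0)// addr_ge0// mulr_ge0// subr_ge0// ge_min lexx ?orbT.
(* Passing from [d] to [c] lifts the new barrier by (c - d) g(t) >= 2 [eps]: one [eps] pays for the
   enlarged box in [transport_le], the other makes the bound on the supremum strict. *)
pose eps := (c - d) * m / 2.
have eps0 : 0 < eps by rewrite divr_gt0// mulr_gt0// subr_gt0.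
apply: (@le_trans _ _ (Q (tilt_le u b' (c * lam - eps)))); last first.
  apply: le_measure; rewrite ?inE.
  - exact: measurable_tilt_le.
  - exact: measurable_sup_tilt_lt.
  move=> w h; rewrite /sup_tilt_lt /=.
  apply: (@le_lt_trans _ _ (c * lam - eps)); last by rewrite gtrBl.
  apply: ge_sup; last by move=> _ [t tu <-]; exact: h.
  by exists (omega 0 w + b' * 0), 0 => //=; rewrite in_itv/= lexx ltW.
apply: le_measure_tilt_le => // i.
(* Levels for which the transported box demands w(theta(t)) <= d - b theta(t), a consequence of
   [tilt_le]. *)
pose l := [seq (t, (lam + k * t) * (d - b * clock lam k t)) | t <- rat_times u i].
have lE : unzip1 l = rat_times u i by rewrite /unzip1 -map_comp map_id.
have pl : path <%R 0 (unzip1 l) by rewrite lE; exact: rat_times_path.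
have lu : all (< u) (unzip1 l) by rewrite lE; exact: rat_times_lt.
apply: (@le_trans _ _ (Q (below u (transport u lam l)))).
  have tu' t : t \in rat_times u i -> clock lam k t \in `[0, u].
    move=> ti; have [pT uT] := transport_path u u0 lam l l0 pl lu.
    have := times_in _ _ pT uT
      (clock lam k t, (lam + k * t) * (d - b * clock lam k t) / (lam + k * t)).
    by apply; rewrite /transport -map_comp; apply/mapP; exists t.
  apply: le_measure; rewrite ?inE; [exact: measurable_tilt_le| |].
    apply: measurable_below => _ /mapP[_ /mapP[t ti ->] ->]; exact: tu'.
  move=> w h _ /mapP[_ /mapP[t ti ->] ->] /=.
  have g0 : lam + k * t != 0.
    by rewrite gt_eqF// (lt_le_trans m0)// mk// (rat_times_in _ i).
  by rewrite mulrAC mulfV// mul1r lerBrDr h// tu'.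
apply: (le_trans (transport_le _ _ _ _ u0 l0 bQ l eps pl lu eps0)).
apply: le_measure; rewrite ?inE.
- apply: measurable_below => _ /mapP[_ /mapP[t ti ->] ->];
  exact: (rat_times_in _ _ _ ti).
- by apply: measurable_below; exact: tilted_levels_in.
move=> w h _ /mapP[t ti ->] /=.
have mt := mk t (rat_times_in _ _ _ ti).
have gt0 : 0 < lam + k * t by exact: lt_le_trans mt.
have := h (t, (lam + k * t) * (d - b * clock lam k t) + eps).
rewrite /relax -map_comp => /(_ _)/= ht; apply: le_trans (ht _) _.
  by apply/mapP; exists t.
have -> : (lam + k * t) * (d - b * clock lam k t) = (lam + k * t) * d - b / lam * t.
  by rewrite /clock; field; rewrite !gt_eqF.
have : (c - d) * m <= (c - d) * (lam + k * t) by rewrite ler_wpM2l// subr_ge0 ltW.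
rewrite /b' /eps; lra.
Qed.

Theorem theorem17 (R : realType) (delta a u b : R)
    (P : probability (pathSpace u) R) :
  0 < delta -> 0 < a -> 0 < u -> b < a / u ->
  bessel_bridge_law delta 0 u 0 P ->
  P [set w | sup [set omega t w + b * t | t in `[0, u]] < a]
  = P [set w | sup [set omega t w | t in `[0, u]]
               < Num.sqrt (a * (a - b * u))].
Proof.
move=> _ a0 u0 bau bP; set m := Num.sqrt _.
have abu : 0 < a - b * u by rewrite subr_gt0 -ltr_pdivlMr.
have m0 : 0 < m by rewrite sqrtr_gt0 mulr_gt0.
have mE : m ^+ 2 = a * (a - b * u) by rewrite sqr_sqrtr// mulr_ge0 ?ltW.
have -> : [set w | sup [set omega t w | t in `[0, u]] < m] = sup_tilt_lt u 0 m.
  have E w : [set omega t w | t in `[0, u]] = [set omega t w + 0 * t | t in `[0, u]].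
    by apply: eq_imagel => t _; rewrite mul0r addr0.
  by apply/seteqP; split=> w; rewrite /sup_tilt_lt /= E.
apply/eqP; rewrite eq_le; apply/andP; split.
(* [m / a] equals sqrt((a - b u)/a); the new slope vanishes because m^2 = a (a - b u). *)
- have := sup_tilt_lt_transport R delta u (m / a) b a P u0 (divr_gt0 m0 a0) bP.
  rewrite (_ : a * (m / a) = m); last by field; rewrite gt_eqF.
  rewrite (_ : b / _ - _ = 0)//; rewrite /bridge_slope.
  apply: (@mulIf _ (m * u)); first by rewrite mulf_neq0 ?gt_eqF.
  rewrite mul0r.
  have -> : (b / (m / a) - a * (((m / a)^-1 - m / a) / u)) * (m * u) =
    b * a * u - a * a + m ^+ 2 by field; rewrite !gt_eqF.
  by rewrite mE; ring.
(* The inverse parameter turns the constant barrier [m] back into a - b t. *)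
- have := sup_tilt_lt_transport R delta u (a / m) 0 m P u0 (divr_gt0 a0 m0) bP.
  rewrite (_ : m * (a / m) = a); last by field; rewrite gt_eqF.
  rewrite (_ : 0 / _ - _ = b)//; rewrite /bridge_slope.
  apply: (@mulIf _ (a * u)); first by rewrite mulf_neq0 ?gt_eqF.
  have -> : (0 / (a / m) - m * (((a / m)^-1 - a / m) / u)) * (a * u) =
    a * a - m ^+ 2 by field; rewrite !gt_eqF.
  by rewrite mE; ring.
Qed.
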